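(* Let $r,p,n$ be positive integers with $p \mid r$, let $\zeta$ be a primitive $r$-th root of unity, and let $w \in G(r,p,n)$. Write $\mathbf{RS}(w)=(\mathbf{P},\mathbf{Q})$ for its image under the generalized Robinson-Schensted map. Then for every $0 \le i \le r-1$, $$\mathrm{sgn}_i(w) = (-1)^{e(\mathbf{P})}\cdot (\zeta^i)^{\mathrm{spin}(\mathbf{P})+\mathrm{spin}(\mathbf{Q})}\cdot \mathrm{sign}(\mathbf{P})\cdot \mathrm{sign}(\mathbf{Q}),$$ where $e(\mathbf{P})$ is the total sum of the lengths of the even-indexed rows of the component tableaux of $\mathbf{P}$.
   Context: **Groups.** $G(r,p,n)$ is the subgroup of $GL_n(\mathbb{C})$ of matrices whose entries are $0$ or powers of $\zeta$, with exactly one non-zero entry in each row and column, and such that the $(r/p)$-th power of the product of all non-zero entries is $1$. Put $W_n = G(r,1,n)$, which contains $G(r,p,n)$. Write $[\zeta^{a_1}\sigma_1,\ldots,\zeta^{a_n}\sigma_n]$ (with $0\le a_i<r$) for the matrix whose non-zero entry in column $i$ is $\zeta^{a_i}$ and lies in row $\sigma_i$. The group $W_n$ is generated by $s_0=[\zeta\cdot 1,2,\ldots,n]$ and $s_j=[1,\ldots,j-1,j+1,j,j+2,\ldots,n]$ for $1\le j\le n-1$. **Sign representations.** For $0\le i\le r-1$, $\mathrm{sgn}_i$ is the one-dimensional representation of $W_n$ determined by $\mathrm{sgn}_i(s_0)=\zeta^i$ and $\mathrm{sgn}_i(s_j)=-1$ for $1\le j\le n-1$. It is a representation of $G(r,p,n)$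 by restriction. **Multitableaux.** A multipartition of rank $n$ is an $r$-tuple $\boldsymbol\lambda=(\lambda^0,\ldots,\lambda^{r-1})$ of (possibly empty) partitions whose ranks sum to $n$. A standard Young tableau of shape $\boldsymbol\lambda$ is a filling of the boxes of the $r$-tuple of Young diagrams of $\lambda^0,\ldots,\lambda^{r-1}$ with $1,\ldots,n$, each used exactly once, such that labels increase along rows and down columns within each component. **Generalized Robinson-Schensted map.** For $w=[\zeta^{a_1}\sigma_1,\ldots,\zeta^{a_n}\sigma_n]\in W_n$ and $0\le k<r$, let $w^{(k)}$ be the sequence of those $\sigma_i$ with $a_i=k$, in increasing order of $i$. Let $(P_k,Q_k)$ be the image of $w^{(k)}$ under the classical Robinson-Schensted (row insertion) map: $P_k$ is the insertion tableau, and $Q_k$ is the recording tableau in which the box added upon inserting $\sigma_i$ is labeled by its position $i$ in $w$. Then $\mathbf{P}(w)=(P_0,\ldots,P_{r-1})$, $\mathbf{Q}(w)=(Q_0,\ldots,Q_{r-1})$ and $\mathbf{RS}(w)=(\mathbf{P}(w),\mathbf{Q}(w))$. **Statistics.** For a tableau $T$, $\mathrm{Inv}(T)$ is the set of pairs $(i,j)$ of labels of $T$ with $j>i$ such that the box labeled $i$ is in a row strictly below the box labeled $j$. For a multitableau $\mathbf{T}=(T_0,\ldots,T_{r-1})$, $$\mathrm{Inv}(\mathbf{T})=\bigsqcup_k \mathrm{Inv}(T_k)\sqcup\bigsqcup_{k<l}\mathrm{Inv}(T_k,T_l),\qquad \mathrm{Inv}(T_k,T_l)=\{(j,i) : j>i,\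 j\text{ a label in }T_k,\ i\text{ a label in }T_l\}.$$ Put $\mathrm{inv}(\mathbf{T})=|\mathrm{Inv}(\mathbf{T})|$ and $\mathrm{sign}(\mathbf{T})=(-1)^{\mathrm{inv}(\mathbf{T})}$. For a tableau $T$, $e(T)$ is the number of boxes in rows of even index (rows numbered from $1$ at the top), and $e(\mathbf{T})=\sum_{k=0}^{r-1}e(T_k)$. Finally $\mathrm{spin}(\mathbf{T})=\frac12\sum_{k=0}^{r-1}k\cdot|\mathrm{sh}(T_k)|$, where $|\mathrm{sh}(T_k)|$ is the number of boxes of $T_k$. (Since $\mathbf{P}$ and $\mathbf{Q}$ have the same shape, $\mathrm{spin}(\mathbf{P})+\mathrm{spin}(\mathbf{Q})$ is an integer.) *)

(* Defs.v *)
From mathcomp Require Import all_boot all_order all_fingroup all_algebra ring.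

Set Implicit Arguments.
Unset Strict Implicit.
Unset Printing Implicit Defensive.

Import Order.TTheory GRing.Theory Num.Theory.
Local Open Scope ring_scope.

Section ReflectionGroups.
Variable C : numClosedFieldType.

(* G(r, p, n), as a predicate on n x n matrices; such matrices are
   automatically invertible. *)
Definition inG (r p n : nat) (zeta : C) (w : 'M[C]_n) : Prop :=
  [/\ forall i j, w i j = 0 \/ exists k : nat, w i j = zeta ^+ k,
      forall i, exists! j, w i j != 0,
      forall j, exists! i, w i j != 0
    & (\prod_i \prod_(j | w i j != 0) w i j) ^+ (r %/ p) = 1].

Definition inW (r n : nat) (zeta : C) (w : 'M[C]_n) : Prop := inG r 1 zeta w.

(* The matrix [zeta^(a 0) sigma 0, ..., zeta^(a (n-1)) sigma (n-1)]: the
   nonzero entry of column j is zeta^(a j), in row sigma j.  Rows and columns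
   are numbered from 0 here; the labels below are shifted to 1, ..., n. *)
Definition window (n : nat) (zeta : C) (a : 'I_n -> nat) (sigma : 'S_n) :
  'M[C]_n := \matrix_(i, j) (if i == sigma j then zeta ^+ a j else 0).

Definition gen0 (n : nat) (zeta : C) : 'M[C]_n :=
  window zeta (fun j => ((j : nat) == 0%N) : nat) 1%g.

Definition gen_swap (n : nat) (zeta : C) (j k : 'I_n) : 'M[C]_n :=
  window zeta (fun=> 0%N) (tperm j k).

(* chi restricts to the one-dimensional representation sgn_i of W_n; its values
   outside W_n are irrelevant, and those on W_n are determined since the s_j
   generate W_n (existence: sgn_exists).  The pairs (j, k) with k = j + 1 index
   s_1, ..., s_(n-1). *)
Record is_sgn (r n : nat) (zeta : C) (i : nat) (chi : 'M[C]_n -> C) : Prop :=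
  IsSgn {
    sgn_1 : chi 1%:M = 1;
    sgn_M : forall u v, inW r zeta u -> inW r zeta v ->
              chi (u *m v) = chi u * chi v;
    sgn_gen0 : chi (gen0 n zeta) = zeta ^+ i;
    sgn_gen_swap : forall j k : 'I_n, k = j.+1 :> nat ->
              chi (gen_swap zeta j k) = -1
  }.

End ReflectionGroups.

Section SignRepresentation.
Variables (C : numClosedFieldType) (r n : nat) (zeta : C).

Let entries (w : 'M[C]_n) : C := \prod_j \sum_i w i j.

Let window0 (a : 'I_n -> nat) (sigma : 'S_n) :
  window zeta a sigma
    = (perm_mx sigma)^T *m diag_mx (\row_j zeta ^+ a j).
Proof.
apply/matrixP=> i j; rewrite mul_mx_diag !mxE eq_sym.
by case: eqP => _; rewrite ?mul1r ?mul0r.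
Qed.

Let det_window (a : 'I_n -> nat) (sigma : 'S_n) :
  \det (window zeta a sigma) = (-1) ^+ sigma * \prod_j zeta ^+ a j.
Proof.
rewrite window0 det_mulmx det_tr det_perm det_diag; congr (_ * _).
by apply: eq_bigr => j _; rewrite mxE.
Qed.

Let entries_window (a : 'I_n -> nat) (sigma : 'S_n) :
  entries (window zeta a sigma) = \prod_j zeta ^+ a j.
Proof.
apply: eq_bigr => j _; rewrite (bigD1 (sigma j)) //= mxE eqxx.
by rewrite big1 ?addr0 // => i /negPf ne; rewrite mxE ne.
Qed.

Let entriesM (u v : 'M[C]_n) :
  inW r zeta v -> entries (u *m v) = entries u * entries v.
Proof.
case=> _ rowv colv _.
have [tau tauP] : exists tau : 'I_n -> 'I_n,
    forall j, v (tau j) j != 0 /\ forall i, v i j != 0 -> tau j = i.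
  apply: (@fin_all_exists _ _ (fun j t => v t j != 0 /\
    forall i, v i j != 0 -> t = i)) => j.
  by have [i [? ?]] := colv j; exists i.
have tau_inj : injective tau.
  move=> j k eq_jk; have [l [_ lP]] := rowv (tau j).
  rewrite -(lP j) ?(lP k) //; first by rewrite eq_jk; case: (tauP k).
  by case: (tauP j).
have v0 i j : i != tau j -> v i j = 0.
  by move=> ne; apply: contraNeq ne => /(proj2 (tauP j)) ->.
rewrite [entries u](reindex_inj tau_inj) /= -big_split /=.
apply: eq_bigr => j _.
under [LHS]eq_bigr => i _ do rewrite mxE.
rewrite exchange_big (bigD1 (tau j)) //= [X in _ + X]big1 ?addr0.
  rewrite mulr_suml [in RHS](eq_bigr (fun i => u i (tau j) * v (tau j) j)) //.
  move=> i _; congr (_ * _).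
  by rewrite (bigD1 (tau j)) //= big1 ?addr0 // => k /v0.
by move=> k /v0 vkj; apply: big1 => i _; rewrite vkj mulr0.
Qed.

Lemma sgn_exists (i : nat) :
  (0 < n)%N -> zeta != 0 -> exists chi, is_sgn r zeta i (chi : 'M[C]_n -> C).
Proof.
move=> n_gt0 zeta0; exists (fun w => \det w * (entries w)^-1 * entries w ^+ i).
have gen0E : \prod_j zeta ^+ (((j : 'I_n) : nat) == 0%N) = zeta.
  rewrite (bigD1 (Ordinal n_gt0)) //= expr1 big1 ?mulr1 // => j.
  by rewrite -val_eqE /= => /negPf->.
split.
- have -> : 1%:M = window zeta (fun=> 0%N) 1%g :> 'M_n.
    apply/matrixP=> a b; rewrite !mxE perm1.
    by case: eqP => _; rewrite ?expr0.
  by rewrite entries_window det_window odd_perm1 !big1 ?invr1 ?expr1n ?mulr1.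
- by move=> u v _ Wv; rewrite det_mulmx entriesM // invfM exprMn; ring.
- rewrite /gen0 entries_window det_window odd_perm1 gen0E expr0 mul1r.
  by rewrite mulfV // mul1r.
- move=> j k jk; rewrite /gen_swap entries_window det_window odd_tperm.
  rewrite -val_eqE /= jk neq_ltn ltnSn /=.
  by rewrite !big1 // invr1 expr1n !mulr1 expr1.
Qed.

End SignRepresentation.

(* A tableau is the list of its rows, from top to bottom. *)
Definition tableau := seq (seq nat).

Definition multitableau (r : nat) := 'I_r -> tableau.

(* Row insertion of x; also returns the (0-based) index of the row in which the
   new box appears. *)
Fixpoint row_insert (x : nat) (T : tableau) : tableau * nat :=
  match T with
  | [::] => ([:: [:: x]], 0)
  | row :: T' =>
      let c := find (fun y => x < y)%N row in
      if (c < size row)%N then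
        let: (T'', k) := row_insert (nth 0 row c) T' in
        (set_nth 0 row c x :: T'', k.+1)
      else (rcons row x :: T', 0)
  end%N.

Definition add_box (k x : nat) (T : tableau) : tableau :=
  set_nth [::] T k (rcons (nth [::] T k) x).

Definition rs_step (PQ : tableau * tableau) (x : nat * nat) :
    tableau * tableau :=
  let: (P', k) := row_insert x.1 PQ.1 in (P', add_box k x.2 PQ.2).

(* The letters are pairs (inserted value, recording label). *)
Definition rs (s : seq (nat * nat)) : tableau * tableau :=
  foldl rs_step ([::], [::]) s.

(* w^(k), each letter sigma_j being paired with its position j in w: for k < r,
   the entry (i, j) of w is zeta^k exactly when a_j = k and sigma_j = i
   (see subword_window). *)
Definition subword (C : numClosedFieldType) (n : nat) (zeta : C) (w : 'M[C]_n)
    (k : nat) : seq (nat * nat) :=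
  [seq ((i : 'I_n).+1, (j : 'I_n).+1)
     | j <- enum 'I_n, i <- [seq i <- enum 'I_n | w i j == zeta ^+ k]].

Lemma subword_window (C : numClosedFieldType) (r n : nat) (zeta : C)
    (a : 'I_n -> 'I_r) (sigma : 'S_n) (k : 'I_r) :
  r.-primitive_root zeta ->
  subword zeta (window zeta a sigma) k =
    [seq ((sigma j).+1, j.+1) | j <- enum 'I_n & a j == k].
Proof.
move=> prim; rewrite /subword /=.
have filterE j : [seq i <- enum 'I_n | window zeta a sigma i j == zeta ^+ k]
    = if a j == k then [:: sigma j] else [::].
  have eqE i : (window zeta a sigma i j == zeta ^+ k)
      = (a j == k) && (i == sigma j).
    rewrite mxE; case: (i == sigma j); last first.
      rewrite andbF eq_sym expf_eq0; apply/negbTE/nandP; right.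
      apply: contra_eqN (prim_expr_order prim) => /eqP->.
      by rewrite expr0n (gtn_eqF (prim_order_gt0 prim)) eq_sym oner_eq0.
    by rewrite (eq_prim_root_expr prim) !modn_small // andbT.
  rewrite (eq_filter eqE); case: eqP => _ /=; last exact: filter_pred0.
  exact: filter_pred1_uniq (enum_uniq _) (mem_enum _ _).
under eq_map => j do rewrite filterE.
by elim: (enum 'I_n) => //= j s ->; case: ifP.
Qed.

(* RS(w) = (P(w), Q(w)), with components indexed by 0 <= k < r. *)
Definition RS (C : numClosedFieldType) (r n : nat) (zeta : C) (w : 'M[C]_n) :
    multitableau r * multitableau r :=
  (fun k : 'I_r => (rs (subword zeta w k)).1,
   fun k : 'I_r => (rs (subword zeta w k)).2).

Definition labels (T : tableau) : seq nat := flatten T.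

Definition nboxes (T : tableau) : nat := size (labels T).

(* 0-based index of the row containing the label i *)
Definition row_of (T : tableau) (i : nat) : nat :=
  find (fun row => i \in row) T.

(* In a tableau labels are pairwise distinct, so the following lists are
   duplicate-free and their sizes are the cardinals of the corresponding sets of pairs. *)
Definition Inv1 (T : tableau) : seq (nat * nat) :=
  [seq ij <- [seq (i, j) | i <- labels T, j <- labels T]
     | (ij.1 < ij.2)%N && (row_of T ij.2 < row_of T ij.1)%N].

Definition Inv2 (T U : tableau) : seq (nat * nat) :=
  [seq ji <- [seq (j, i) | j <- labels T, i <- labels U] | (ji.2 < ji.1)%N].

Definition inv (r : nat) (T : multitableau r) : nat :=
  (\sum_k size (Inv1 (T k))
   + \sum_(k < r) \sum_(l < r | k < l) size (Inv2 (T k) (T l)))%N.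

Definition sign (R : pzRingType) (r : nat) (T : multitableau r) : R :=
  (-1) ^+ inv T.

(* The rows of even index, counted from 1, have odd index counted from 0. *)
Definition e1 (T : tableau) : nat :=
  (\sum_(k < size T | odd k) size (nth [::] T k))%N.

Definition e (r : nat) (T : multitableau r) : nat := (\sum_k e1 (T k))%N.

(* A half-integer in general; for (P, Q) = RS(w), spin P + spin Q is a natural
   number (spin_RS_nat), so that Num.truncn (spin P + spin Q) is its value. *)
Definition spin (r : nat) (T : multitableau r) : rat :=
  2^-1 * \sum_(k < r) (k * nboxes (T k))%:R.

Lemma spin_RS_nat (C : numClosedFieldType) (r n : nat) (zeta : C)
    (w : 'M[C]_n) :
  spin (RS r zeta w).1 + spin (RS r zeta w).2 \is a Num.nat.
Proof.
have insE x T : nboxes (row_insert x T).1 = (nboxes T).+1.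
  rewrite /nboxes /labels; elim: T x => //= row T IH x.
  case: ifP => [lt_c|_] /=; last first.
    by rewrite !size_cat size_rcons.
  case: row_insert (IH (nth 0%N row (find (fun y => (x < y)%N) row))).
  move=> T'' k /= eqT; rewrite !size_cat size_set_nth eqT addnS.
  by rewrite (maxn_idPr lt_c).
have addE k x T : nboxes (add_box k x T) = (nboxes T).+1.
  rewrite /nboxes /labels /add_box; elim: k T => [|k IH] [|row T] //=.
  - by rewrite !size_cat size_rcons.
  - by elim: k {IH}.
  - by rewrite !size_cat IH addnS.
have rsE s : nboxes (rs s).1 = nboxes (rs s).2.
  elim/last_ind: s => // s x IH; rewrite /rs foldl_rcons -/(rs s) /rs_step.
  case: row_insert (insE x.1 (rs s).1) => T k /= ->.
  by rewrite addE IH.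
rewrite /spin /RS /=.
under eq_bigr => k _ do rewrite rsE.
by rewrite -mulr2n -[_ *+ 2]mulr_natl mulVKf // -natr_sum natr_nat.
Qed.

(* Main.v *)
(** Writing w = [zeta^(a_1) sigma_1, ..., zeta^(a_n) sigma_n], a descent
    argument with adjacent transpositions gives
      sgn_i(w) = (-1)^(number of inversions of sigma) (zeta^i)^(sum of the a_j),
    and the exponent of zeta^i is spin(P) + spin(Q).  An inversion of sigma
    joins two letters of the same color or of distinct colors.
    For distinct colors k < l, a pair of letters is an inversion exactly when
    one, but not both, of its values and its positions are in decreasing order,
    so modulo 2 these pairs contribute |Inv(P_k, P_l)| + |Inv(Q_k, Q_l)|.
    For one color the classical identity inv(w) = e(P) + inv(P) + inv(Q) mod 2
    is proved one insertion at a time: if the new box is in row k, then e(P)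
    grows by [k is even], inv(Q) by the number of boxes strictly below row k,
    and the change of inv(P) is computed by following the bumping path. *)
Require Import Defs.
From mathcomp Require Import all_boot all_order all_fingroup all_algebra ring zify.

Set Implicit Arguments.
Unset Strict Implicit.
Unset Printing Implicit Defensive.

(** * Inversions between lists of labels *)

Lemma count_sum (T : Type) (a : pred T) (s : seq T) :
  count a s = \sum_(x <- s) a x.
Proof. by elim: s => [|x s IH]; rewrite ?big_nil ?big_cons //= IH. Qed.

(** Common form of [Inv2] and of the part of [Inv1] that joins one row to the rows below it.
    Permuting either list does not change it, so the labels of a tableau can be traded for the
    letters inserted. *)
Definition cross (s t : seq nat) : nat :=
  \sum_(j <- s) count (fun i => i < j) t.

Lemma perm_cross (s1 s2 t1 t2 : seq nat) :
  perm_eq s1 s2 -> perm_eq t1 t2 -> cross s1 t1 = cross s2 t2.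
Proof.
move=> eq_s /seq.permP eq_t; rewrite /cross (perm_big _ eq_s).
by apply: eq_bigr => j _; apply: eq_t.
Qed.

Lemma cross_cat_l (s1 s2 t : seq nat) :
  cross (s1 ++ s2) t = cross s1 t + cross s2 t.
Proof. exact: big_cat. Qed.

Lemma cross_cons_l (s t : seq nat) (x : nat) :
  cross (x :: s) t = count (gtn x) t + cross s t.
Proof. exact: big_cons. Qed.

Lemma cross_seq1 (x : nat) (t : seq nat) : cross [:: x] t = count (gtn x) t.
Proof. exact: big_seq1. Qed.

Lemma cross_cons_r (s t : seq nat) (x : nat) :
  cross s (x :: t) = count (ltn x) s + cross s t.
Proof.
by rewrite /cross [LHS]/= big_split /= count_sum.
Qed.

Lemma size_Inv2 (T U : tableau) : size (Inv2 T U) = cross (labels T) (labels U).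
Proof.
rewrite /Inv2 size_filter count_sum big_allpairs /cross.
by apply: eq_bigr => j _; rewrite count_sum.
Qed.

Lemma size_Inv1 (T : tableau) :
  size (Inv1 T) = \sum_(i <- labels T) \sum_(j <- labels T)
    ((i < j) && (row_of T j < row_of T i)).
Proof. by rewrite /Inv1 size_filter count_sum big_allpairs. Qed.

Local Arguments row_of : simpl never.

(** By uniqueness, [row_of] sends the labels of [row] to 0 and shifts those of [T] by one. The lower
    box of an inversion is thus in [T]; its partner is in [row], which gives [cross], or in [T]. *)
Lemma size_Inv1_cons (row : seq nat) (T : tableau) :
  uniq (labels (row :: T)) ->
  size (Inv1 (row :: T)) = cross row (labels T) + size (Inv1 T).
Proof.
rewrite /labels /= cat_uniq => /and3P[_ /hasPn disj _].
have row_ofE i : row_of (row :: T) i = if i \in row then 0 else (row_of T i).+1.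
  by [].
rewrite !size_Inv1 /labels /= big_cat /= big1_seq ?add0n; last first.
  move=> i /= i_row; apply: big1 => j _.
  by rewrite [row_of _ i]row_ofE i_row andbF.
rewrite /cross; under [in RHS]eq_bigr do rewrite count_sum.
rewrite [X in _ = X + _]exchange_big /= -big_split /= big_seq [RHS]big_seq.
apply: eq_bigr => i /disj /= i_nrow; rewrite big_cat /=.
congr (_ + _); rewrite big_seq [RHS]big_seq; apply: eq_bigr => j.
  by move=> j_row; rewrite !row_ofE j_row (negPf i_nrow) andbT.
by move=> /disj /= j_nrow; rewrite !row_ofE (negPf i_nrow) (negPf j_nrow).
Qed.

(** * Shapes and the adding of a box *)

Lemma nth_shape (T : tableau) (k : nat) :
  nth 0 (shape T) k = size (nth [::] T k).
Proof.
case: (ltnP k (size T)) => lt_kT; first exact: nth_map.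
by rewrite !nth_default ?size_map.
Qed.

(** Missing rows have length 0; tableaux with different numbers of rows can then be summed over one
    range. *)
Lemma e1_shape (T : tableau) (m : nat) :
  size T <= m -> e1 T = \sum_(k < m | odd k) nth 0 (shape T) k.
Proof.
move=> le_m; rewrite /e1 (big_ord_widen_cond m odd (fun k => size (nth [::] T k))) //.
rewrite [RHS](bigID (fun k : 'I_m => k < size T)) /= [X in _ + X]big1 ?addn0.
  by apply: eq_bigr => k _; rewrite nth_shape.
by move=> k /andP[_ le_k]; rewrite nth_shape nth_default // leqNgt.
Qed.

Lemma e1_incr_shape (T T' : tableau) (k : nat) :
  shape T' = incr_nth (shape T) k -> e1 T' = odd k + e1 T.
Proof.
move=> shT'; pose m := maxn k.+1 (maxn (size T) (size T')).
have lt_km : k < m by rewrite /m; lia.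
rewrite !(@e1_shape _ m) ?shT' /m; try lia.
under eq_bigr do rewrite nth_incr_nth.
rewrite big_split /=; congr (_ + _).
rewrite big_mkcond (bigD1 (Ordinal lt_km)) //= eqxx big1 ?addn0 => [|l]; first by case: odd.
by rewrite -val_eqE /= eq_sym => /negPf->; case: odd.
Qed.

Lemma shape_add_box (k x : nat) (T : tableau) :
  shape (add_box k x T) = incr_nth (shape T) k.
Proof.
apply: (@eq_from_nth _ 0).
  by rewrite size_incr_nth !size_map size_set_nth; case: ltnP; lia.
move=> l _; rewrite nth_incr_nth !nth_shape nth_set_nth /= eq_sym.
by case: eqP => [->|]; rewrite ?size_rcons.
Qed.

Lemma perm_labels_add_box (k x : nat) (T : tableau) :
  perm_eq (labels (add_box k x T)) (x :: labels T).
Proof.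
rewrite /labels /add_box; elim: k T => [|k IH] [|row T] //=.
- by rewrite -cats1 -catA perm_catCA.
- by elim: k {IH}.
- by rewrite -cat1s perm_sym perm_catCA perm_cat2l perm_sym IH.
Qed.

Lemma add_boxS (k x : nat) (row : seq nat) (T : tableau) :
  add_box k.+1 x (row :: T) = row :: add_box k x T.
Proof. by []. Qed.

(** The new label is the largest, so its inversions are exactly with the boxes strictly below its
    row, which [sumn] counts. *)
Lemma inv_add_box (k x : nat) (T : tableau) :
  uniq (labels T) -> all (gtn x) (labels T) -> k <= size T ->
  size (Inv1 (add_box k x T)) =
    size (Inv1 T) + sumn (drop k.+1 (shape T)).
Proof.
elim: k T => [|k IH] [|row T] //; first by rewrite /Inv1 /= ltnn.
- move=> uT ltT _.
  have uT' : uniq (labels (add_box 0 x (row :: T))).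
    rewrite (perm_uniq (perm_labels_add_box _ _ _)) cons_uniq uT andbT.
    by apply/negP => /(allP ltT) /=; rewrite ltnn.
  rewrite !size_Inv1_cons // /= -cats1 cross_cat_l cross_seq1 drop0 -size_flatten.
  have -> : count (gtn x) (labels T) = size (flatten T); last lia.
  by apply/eqP; rewrite -all_count; move: ltT; rewrite /labels /= all_cat => /andP[].
- move=> uT ltT le_k; move: (uT) (ltT); rewrite /labels /= cat_uniq all_cat.
  case/and3P=> _ _ uT1 /andP[_ ltT'].
  have uT' : uniq (labels (add_box k.+1 x (row :: T))).
    rewrite (perm_uniq (perm_labels_add_box _ _ _)) cons_uniq uT andbT.
    by apply/negP => /(allP ltT) /=; rewrite ltnn.
  rewrite add_boxS !size_Inv1_cons // IH //.
  rewrite (perm_cross (perm_refl _) (perm_labels_add_box _ _ _)).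
  rewrite cross_cons_r addnA; congr (_ + _ + _).
  (* No entry of [row] exceeds [x], so [x] creates no crossing with a row above it. *)
  rewrite -[RHS]add0n; congr addn; apply/eqP; rewrite -leqn0 leqNgt -has_count.
  apply/hasPn => y y_row /=; rewrite -leqNgt ltnW //.
  by apply: (allP ltT); rewrite /labels /= mem_cat y_row.
Qed.

(** * Row insertion and inversions modulo 2 *)

Definition sorted_rows (T : tableau) : bool := all (sorted ltn) T.

(** [find] stops at the first entry above [x]; the earlier ones are at most [x], and differ from it
    because [x] is not in the row. *)
Lemma row_bumpP (row : seq nat) (x : nat) :
  sorted ltn row -> x \notin row ->
  let c := find (fun y => x < y) row in c < size row ->
  exists s1 y s2,
    [/\ row = s1 ++ y :: s2, nth 0 row c = y, set_nth 0 row c x = s1 ++ x :: s2,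
        sorted ltn (s1 ++ x :: s2)
      & [/\ all (gtn x) s1, x < y & all (ltn y) s2]].
Proof.
move=> row_srt x_row c lt_c; pose y := nth 0 row c.
have rowE : row = take c row ++ y :: drop c.+1 row.
  by rewrite -drop_nth // cat_take_drop.
have lt_xy : x < y by apply: (@nth_find _ 0 (fun y => x < y)); rewrite has_find.
have lt_s1 : all (gtn x) (take c row).
  apply/(all_nthP 0) => m; rewrite size_takel ?(ltnW lt_c) // => lt_m.
  rewrite nth_take //= ltn_neqAle leqNgt (before_find 0 lt_m) andbT.
  by apply: contra x_row => /eqP <-; rewrite mem_nth // (ltn_trans lt_m lt_c).
move: row_srt; rewrite {1}rowE !(sorted_pairwise ltn_trans) pairwise_cat /=.
rewrite allrel_consr => /and3P[/andP[_ s12] s1_srt /andP[y_s2 s2_srt]].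
exists (take c row), y, (drop c.+1 row); split=> //.
- by rewrite set_nthE lt_c.
- have x_s2 : all (ltn x) (drop c.+1 row).
    by apply: sub_all y_s2 => z; apply: ltn_trans.
  rewrite (sorted_pairwise ltn_trans) pairwise_cat allrel_consr s12 s1_srt /=.
  by rewrite lt_s1 x_s2 s2_srt.
Qed.

Lemma count_ltn_gtn (x : nat) (s : seq nat) :
  x \notin s -> count (ltn x) s + count (gtn x) s = size s.
Proof.
move=> x_s; rewrite -(count_predC (ltn x) s); congr (_ + _).
apply: eq_in_count => y y_s /=; case: ltngtP => // xy.
by rewrite -xy y_s in x_s.
Qed.

(* The entries of [row] after the bumped letter [y] are larger than both [x]
   and [y]; a lower entry is counted with respect to [x] or to [y], and
   [count (ltn z) + count (gtn z)] is the number of all lower entries for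
   either letter [z]. *)
Lemma row_insertP (x : nat) (T : tableau) :
  sorted_rows T -> uniq (x :: labels T) ->
  let: (T', k) := row_insert x T in
  [/\ perm_eq (labels T') (x :: labels T), sorted_rows T',
      shape T' = incr_nth (shape T) k, k <= size T
    & size (Inv1 T') + size (Inv1 T) + count (ltn x) (labels T) + k
        + sumn (drop k.+1 (shape T)) = 0 %[mod 2]].
Proof.
elim: T x => [|row T IH] x; first by rewrite /Inv1 /= ltnn.
rewrite {1}/sorted_rows /= => /andP[row_srt T_srt] xT_uniq.
have T_uniq : uniq (labels (row :: T)) by case/andP: xT_uniq.
have [x_row x_T] : x \notin row /\ x \notin labels T.
  by move: xT_uniq; rewrite /labels /= mem_cat negb_or => /andP[/andP[]].
rewrite [row_insert _ _]/=; case: ifP => [lt_c|/negbT ge_c].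
- have [s1 [y [s2 [rowE -> -> row'_srt [lt_s1 lt_xy lt_s2]]]]] :=
    row_bumpP row_srt x_row lt_c.
  have [y_T yT_uniq] : y \notin labels T /\ uniq (y :: labels T).
    move: T_uniq; rewrite rowE /labels /= cat_uniq => /and3P[_ /hasPn disj ->].
    have yN : y \notin flatten T.
      by apply/negP => /disj /=; rewrite mem_cat mem_head orbT.
    by rewrite yN.
  move: (IH y T_srt yT_uniq); case: row_insert => T' k.
  case=> permT' T'_srt shT' le_k parT'.
  have perm' : perm_eq (labels ((s1 ++ x :: s2) :: T')) (x :: labels (row :: T)).
    apply/seq.permP=> a; move/seq.permP: permT' => /(_ a).
    by rewrite /labels rowE /= ?count_cat /= ?count_cat /= => ->; ring.
  split=> //=.
  + by rewrite /sorted_rows /= row'_srt.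
  + by rewrite shT' rowE !size_cat.
  rewrite !size_Inv1_cons // ?(perm_uniq perm') //.
  rewrite (perm_cross (perm_refl _) permT') cross_cons_r {1}rowE.
  rewrite !cross_cat_l !cross_cons_l.
  have countyE : count (ltn y) (s1 ++ x :: s2) = size s2.
    rewrite count_cat /= ltnNge (ltnW lt_xy) add0n; move: lt_s2; rewrite all_count => /eqP->.
    rewrite (@eq_in_count _ _ pred0) ?count_pred0 // => z /(allP lt_s1) /= lt_zx.
    by rewrite ltnNge ltnW // (ltn_trans lt_zx).
  have countxE :
      count (ltn x) (labels (row :: T)) = (size s2).+1 + count (ltn x) (labels T).
    rewrite /labels rowE /= !count_cat /= lt_xy.
    have /eqP-> : count (ltn x) s2 == size s2.
      by rewrite -all_count; apply: sub_all lt_s2 => z; apply: ltn_trans.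
    rewrite (@eq_in_count _ _ pred0 s1) ?count_pred0 // => z /(allP lt_s1) /= lt_zx.
    by rewrite ltnNge ltnW.
  (* [size s2] enters twice, through [countyE] and [countxE]; the extra unit of [countxE], which is
     [y] itself, cancels the step from [k] to [k.+1]. *)
  have := count_ltn_gtn x_T; have := count_ltn_gtn y_T; rewrite countyE countxE.
  by move: parT'; clear; lia.
- have le_row : all (gtn x) row.
    move: ge_c; rewrite -has_find => /hasPn le_row.
    apply/allP => y y_row /=; move: (le_row y y_row).
    by case: ltngtP => // yx; rewrite yx y_row in x_row.
  have ltx_row : count (ltn x) row = 0.
    rewrite (@eq_in_count _ _ pred0) ?count_pred0 // => z /(allP le_row) /= lt_zx.
    by rewrite ltnNge ltnW.
  have perm' : perm_eq (labels (rcons row x :: T)) (x :: labels (row :: T)).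
    by rewrite /labels /= -cats1 -catA perm_catCA.
  split=> //=.
  + move: row_srt; rewrite /sorted_rows /= T_srt andbT !(sorted_pairwise ltn_trans).
    by rewrite pairwise_rcons le_row => ->.
  + by rewrite size_rcons.
  rewrite !size_Inv1_cons // ?(perm_uniq perm') //.
  (* The new crossings are [count (gtn x)]; with [count (ltn x)] they make up all the lower boxes,
     which cancel [sumn] modulo 2. *)
  rewrite -cats1 cross_cat_l cross_seq1 /labels /= count_cat ltx_row drop0.
  by have := count_ltn_gtn x_T; rewrite -size_flatten /labels; clear; lia.
Qed.

(** * Inversions of words and the Robinson-Schensted map *)

(** Letters are (value, position), and the letter from [s] has the smaller position. Two words are
    allowed because the positions of different colors interleave. *)
Definition winv (s t : seq (nat * nat)) : nat :=
  \sum_(z <- s) \sum_(z' <- t) ((z.2 < z'.2) && (z'.1 < z.1)).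

(** The last letter has the greatest position, so it can only be the later member of an
    inversion. *)
Lemma winv_rcons (s : seq (nat * nat)) (x : nat * nat) :
  all (gtn x.2) (unzip2 s) ->
  winv (rcons s x) (rcons s x) = winv s s + count (ltn x.1) (unzip1 s).
Proof.
rewrite all_map => /allP /= lt_x; rewrite /winv -cats1 big_cat big_seq1 /=.
rewrite [X in _ + X]big1_seq ?addn0; last first.
  move=> z /=; rewrite mem_cat => /orP[/lt_x|]; first by case: ltngtP.
  by rewrite inE => /eqP->; rewrite ltnn.
under eq_bigr do rewrite big_cat big_seq1.
rewrite big_split /= count_map count_sum; congr (_ + _).
by rewrite big_seq [RHS]big_seq; apply: eq_bigr => z /lt_x /= ->.
Qed.

(** Induction on the last letter: the increments given by [winv_rcons] and [inv_add_box] are exactly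
    the terms [count] and [sumn] of [row_insertP]. *)
Lemma rs_parity (s : seq (nat * nat)) :
  sorted ltn (unzip2 s) -> uniq (unzip1 s) ->
  [/\ perm_eq (labels (rs s).1) (unzip1 s),
      perm_eq (labels (rs s).2) (unzip2 s)
    & winv s s = e1 (rs s).1 + size (Inv1 (rs s).1) + size (Inv1 (rs s).2)
      %[mod 2]].
Proof.
move=> s_srt s_uniq.
(* The induction also needs sorted rows for the next insertion, and equal shapes because
   [inv_add_box] refers to the recording tableau and [row_insertP] to the insertion tableau. *)
suff [] : [/\ perm_eq (labels (rs s).1) (unzip1 s),
      perm_eq (labels (rs s).2) (unzip2 s),
      shape (rs s).1 = shape (rs s).2, sorted_rows (rs s).1
    & winv s s = e1 (rs s).1 + size (Inv1 (rs s).1) + size (Inv1 (rs s).2)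
      %[mod 2]] by [].
elim/last_ind: s s_srt s_uniq => [|s x IH].
  by rewrite /rs /= /winv /e1 /Inv1 !big_nil big_ord0.
rewrite /unzip1 /unzip2 !map_rcons rcons_uniq (sorted_pairwise ltn_trans).
rewrite pairwise_rcons -(sorted_pairwise ltn_trans) => /andP[lt_x s_srt].
case/andP=> x_s s_uniq; have [permP permQ shPQ P_srt parity] := IH s_srt s_uniq.
rewrite winv_rcons // /rs foldl_rcons -/(rs s) /rs_step.
have xP_uniq : uniq (x.1 :: labels (rs s).1).
  by rewrite /= (perm_uniq permP) (perm_mem permP) x_s.
have Q_uniq : uniq (labels (rs s).2).
  by rewrite (perm_uniq permQ) (sorted_uniq ltn_trans ltnn).
have lt_Q : all (gtn x.2) (labels (rs s).2) by rewrite (perm_all _ permQ).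
move: (row_insertP P_srt xP_uniq); case: row_insert => P' k /=.
case=> permP' P'_srt shP' le_k parity'.
have le_kQ : k <= size (rs s).2 by rewrite -(size_map size) -/(shape _) -shPQ size_map.
split.
- by rewrite perm_sym perm_rcons perm_sym (perm_trans permP') ?perm_cons.
- by rewrite perm_sym perm_rcons perm_sym (perm_trans (perm_labels_add_box _ _ _)) ?perm_cons.
- by rewrite shape_add_box shP' shPQ.
- by [].
rewrite (e1_incr_shape shP') inv_add_box // -shPQ.
have /seq.permP <- := permP.
(* [row_insertP] contains [k], whereas [e1] grows by [odd k]. *)
move: parity parity'; rewrite -[k](odd_double_half k) oddD odd_double.
by clear; case: (odd k) => /=; lia.
Qed.

Lemma winv_cross (s t : seq (nat * nat)) :
  (forall z z', z \in s -> z' \in t -> z.1 != z'.1 /\ z.2 != z'.2) ->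
  winv s t + winv t s
    = cross (unzip1 s) (unzip1 t) + cross (unzip2 s) (unzip2 t) %[mod 2].
Proof.
move=> disj; apply/eqP; rewrite eq_sym; apply/eqP.
(* Pairs with [z] larger in both coordinates count twice on the [cross] side and never in [winv];
   adding [2 * both] makes the congruence an equality, checked pair by pair. *)
pose both := \sum_(z <- s) \sum_(z' <- t) ((z'.2 < z.2) && (z'.1 < z.1)).
rewrite -[RHS](modnMDl both); congr (_ %% 2).
rewrite /winv /both /cross [X in _ + (_ + X)]exchange_big !big_map -!big_split.
rewrite big_distrl -!big_split /= big_seq [RHS]big_seq; apply: eq_bigr => z zs.
rewrite !count_map !count_sum big_distrl -!big_split /= big_seq [RHS]big_seq.
apply: eq_bigr => z' z't; have [] := disj z z' zs z't.
by rewrite /=; case: (ltngtP z.1); case: (ltngtP z.2).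
Qed.

Lemma eq_sum_mod (d : nat) (I : finType) (P : pred I) (F G : I -> nat) :
  (forall i, P i -> F i = G i %[mod d]) ->
  \sum_(i | P i) F i = \sum_(i | P i) G i %[mod d].
Proof.
by move=> eqFG; rewrite -modn_summ (eq_bigr _ eqFG) modn_summ.
Qed.

Lemma sum_ord_symmetrize (r : nat) (f : 'I_r -> 'I_r -> nat) :
  \sum_k \sum_l f k l
    = \sum_k f k k + \sum_(k < r) \sum_(l < r | k < l) (f k l + f l k).
Proof.
under [X in _ + X]eq_bigr do rewrite big_split.
rewrite big_split /= [X in _ + (_ + X)](exchange_big_dep xpredT) //= -!big_split /=.
apply: eq_bigr => k _; rewrite (bigD1 k) //=; congr (_ + _).
rewrite (bigID (fun l : 'I_r => k < l)) /=; congr (_ + _); apply: eq_bigl => l;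
  by rewrite -val_eqE /=; case: ltngtP.
Qed.

Import Order.TTheory GRing.Theory Num.Theory.
Local Open Scope ring_scope.

(** * Inversions and descents of a permutation *)

Definition ninv (n : nat) (s : 'S_n) : nat :=
  (\sum_(p < n) \sum_(q < n) ((p < q) && (s q < s p)))%N.

(** Exchanging two adjacent positions alters the relative order of no other pair of positions. *)
Lemma inversion_tperm (n : nat) (f : 'I_n -> nat) (j k p q : 'I_n) :
  k = j.+1 :> nat -> (f k < f j)%N ->
  ((p < q) && (f q < f p)
    = (tperm j k p < tperm j k q) && (f q < f p) + ((p == j) && (q == k))
    :> nat)%N.
Proof.
move=> jk desc.
by case: tpermP => [->|->|/eqP + /eqP +]; case: tpermP => [->|->|/eqP + /eqP +];
  rewrite -!val_eqE /=; lia.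
Qed.

(** Permutations compose left factor first, so [tperm j k * s] exchanges the values of [s] at
    positions [j] and [k]. After reindexing both sums, only the pair [(j, k)] differs. *)
Lemma ninv_descent (n : nat) (s : 'S_n) (j k : 'I_n) :
  k = j.+1 :> nat -> (s k < s j)%N -> ninv s = (ninv (tperm j k * s)%g).+1.
Proof.
move=> jk desc; rewrite /ninv.
rewrite [in RHS](reindex_inj (@perm_inj _ (tperm j k))) /=.
under [in RHS]eq_bigr => p _.
  rewrite (reindex_inj (@perm_inj _ (tperm j k))) /=.
  under eq_bigr => q _ do rewrite !permM !tpermK.
  over.
under eq_bigr => p _.
  under eq_bigr => q _ do rewrite (@inversion_tperm _ (fun x => s x) j k) //.
  rewrite big_split.
  over.
rewrite big_split /= -addn1; congr addn.
rewrite (bigD1 j) //= (bigD1 k) //= !eqxx /= !big1 // => [p /negPf-> | q /negPf->] //.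
by apply: big1.
Qed.

(** Without a descent the list of values is strictly increasing; being a permutation of [iota 0 n],
    it equals that list. *)
Lemma perm_descent (n : nat) (s : 'S_n) :
  s != 1%g -> exists j k : 'I_n, k = j.+1 :> nat /\ (s k < s j)%N.
Proof.
move=> s_neq1; have [/existsP[j /existsP[k /andP[/eqP]]]|no_desc] := boolP
    [exists j : 'I_n, exists k : 'I_n, (k == j.+1 :> nat) && (s k < s j)%N].
  by exists j, k.
case/eqP: s_neq1; apply/permP => j; rewrite perm1.
pose t := [seq val (s k) | k <- enum 'I_n].
have nth_t m (lt_m : (m < n)%N) : nth 0%N t m = s (Ordinal lt_m).
  by rewrite (nth_map j) ?size_enum_ord // (nth_ord_enum _ (Ordinal lt_m)).
have srt : sorted ltn t.
  apply/(sortedP 0%N) => m; rewrite size_map size_enum_ord => lt_m.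
  have lt_m' := ltnW lt_m.
  rewrite (nth_t m lt_m') (nth_t m.+1 lt_m) /= ltn_neqAle; apply/andP; split.
    by rewrite val_eqE (inj_eq perm_inj) -val_eqE /= neq_ltn ltnSn.
  rewrite leqNgt; apply: contra no_desc => desc.
  apply/existsP; exists (Ordinal lt_m'); apply/existsP; exists (Ordinal lt_m).
  by rewrite eqxx.
have perm_t : perm_eq t (iota 0 n).
  apply: uniq_perm (iota_uniq _ _) _.
    by rewrite map_inj_uniq ?enum_uniq //; apply: inj_comp val_inj perm_inj.
  move=> m; rewrite mem_iota add0n; apply/mapP/idP => [[k _ ->]|lt_m]; first exact: ltn_ord.
  by exists ((s^-1)%g (Ordinal lt_m)); rewrite ?mem_enum ?permKV.
have tE : t = iota 0 n.
  exact: irr_sorted_eq ltn_trans ltnn _ _ srt (iota_ltn_sorted _ _) (perm_mem perm_t).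
apply: val_inj; have := nth_t j (ltn_ord j); rewrite tE nth_iota ?ltn_ord // add0n.
by move=> jE; rewrite /= [RHS]jE; congr (val (s _)); apply: val_inj.
Qed.

(** * Values of the sign representations on monomial matrices *)

Section Sgn.
Variables (C : numClosedFieldType) (r n : nat) (zeta : C).
Hypothesis zeta_prim : r.-primitive_root zeta.

Lemma eq_window (a b : 'I_n -> nat) (s : 'S_n) :
  a =1 b -> window zeta a s = window zeta b s.
Proof. by move=> eq_ab; apply/matrixP=> i j; rewrite !mxE eq_ab. Qed.

Lemma window1 : window zeta (fun=> 0%N) 1%g = 1%:M :> 'M[C]_n.
Proof.
by apply/matrixP=> i j; rewrite !mxE perm1; case: eqP; rewrite ?expr0.
Qed.

(** The right matrix factor acts first on columns, whence [t * s] and the exponent [a (t j)]. *)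
Lemma mul_window (a b : 'I_n -> nat) (s t : 'S_n) :
  window zeta a s *m window zeta b t
    = window zeta (fun j => a (t j) + b j)%N (t * s)%g.
Proof.
apply/matrixP=> i j; rewrite !mxE (bigD1 (t j)) //= !mxE eqxx permM.
rewrite big1 ?addr0 => [|k /negPf ne]; last by rewrite !mxE ne mulr0.
by case: eqP => _; rewrite ?mul0r // exprD.
Qed.

Lemma zeta_neq0 : zeta != 0.
Proof.
apply: contra_eq_neq (prim_expr_order zeta_prim) => ->.
by rewrite expr0n (gtn_eqF (prim_order_gt0 zeta_prim)) eq_sym oner_neq0.
Qed.

Lemma window_neq0 (a : 'I_n -> nat) (s : 'S_n) i j :
  (window zeta a s i j != 0) = (i == s j).
Proof.
rewrite mxE; case: (i =P s j) => _; last by rewrite eqxx.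
by rewrite expf_neq0 // zeta_neq0.
Qed.

Lemma window_inW (a : 'I_n -> nat) (s : 'S_n) : inW r zeta (window zeta a s).
Proof.
split.
- by move=> i j; rewrite mxE; case: eqP => _; [right; exists (a j) | left].
- move=> i; exists (s^-1 i)%g; split=> [|j]; rewrite window_neq0 ?permKV //.
  by move/eqP->; rewrite permK.
- move=> j; exists (s j); split=> [|i]; rewrite window_neq0 //.
  by move/eqP->.
- rewrite divn1 -prodrXl big1 // => i _; rewrite -prodrXl big1 // => j.
  rewrite window_neq0 => /eqP->; rewrite mxE eqxx.
  by rewrite -exprM mulnC exprM (prim_expr_order zeta_prim) expr1n.
Qed.

(** The row of the nonzero entry of each column defines [f], injective because each row has a single
    nonzero entry. Exponents are reduced modulo [r] to give colors in ['I_r]. *)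
Lemma inG_window (p : nat) (w : 'M[C]_n) :
  inG r p zeta w -> exists (a : 'I_n -> 'I_r) (s : 'S_n), w = window zeta a s.
Proof.
case=> entries rowP colP _.
have [f fP] : exists f : 'I_n -> 'I_n,
    forall j, w (f j) j != 0 /\ forall i, w i j != 0 -> f j = i.
  apply: (@fin_all_exists _ _ (fun j t => w t j != 0 /\
    forall i, w i j != 0 -> t = i)) => j.
  by have [i [? ?]] := colP j; exists i.
have f_inj : injective f.
  move=> j k eq_jk; have [l [_ lP]] := rowP (f j).
  rewrite -(lP j) ?(lP k) //; first by rewrite eq_jk; case: (fP k).
  by case: (fP j).
have [a aP] : exists a : 'I_n -> 'I_r, forall j, w (f j) j = zeta ^+ a j.
  apply: (@fin_all_exists _ _ (fun j (c : 'I_r) => w (f j) j = zeta ^+ c)) => j.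
  have [w0|[k ->]] := entries (f j) j; first by case: (fP j); rewrite w0 eqxx.
  exists (Ordinal (ltn_pmod k (prim_order_gt0 zeta_prim))) => /=.
  by rewrite (prim_expr_mod zeta_prim).
exists a, (perm f_inj); apply/matrixP=> i j; rewrite mxE permE.
case: eqP => [->//|ne]; apply/eqP; apply: contra_notT ne => /(proj2 (fP j)) ->//.
Qed.

Variables (i : nat) (chi : 'M[C]_n -> C).
Hypothesis chiP : is_sgn r zeta i chi.

Lemma sgn_mul_window (a b : 'I_n -> nat) (s t : 'S_n) :
  chi (window zeta (fun j => a (t j) + b j)%N (t * s)%g)
    = chi (window zeta a s) * chi (window zeta b t).
Proof.
by rewrite -mul_window (sgn_M chiP) //; apply: window_inW.
Qed.

(** Induction on [ninv]: at a descent an adjacent transposition splits off, with value -1, and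
    [ninv] drops by one. *)
Lemma sgn_perm (s : 'S_n) : chi (window zeta (fun=> 0%N) s) = (-1) ^+ ninv s.
Proof.
have [m] := ubnP (ninv s); elim: m s => // m IH s.
have [-> _|/perm_descent[j [k [jk desc]]]] := eqVneq s 1%g.
  rewrite window1 (sgn_1 chiP) /ninv big1 // => p _; apply: big1 => q _.
  by rewrite !perm1; lia.
rewrite (ninv_descent jk desc) ltnS => lt_m.
rewrite -{1}[s](mulKg (tperm j k)) tpermV.
by rewrite (sgn_mul_window (fun=> 0%N) (fun=> 0%N)) (sgn_gen_swap chiP) // IH // exprS mulrC.
Qed.

(** This matrix is the conjugate of [gen0] by the transposition of the first index and [j]. That
    transposition need not be adjacent; it is enough that its value squares to 1. *)
Lemma sgn_delta (j : 'I_n) :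
  chi (window zeta (fun k => k == j) 1%g) = zeta ^+ i.
Proof.
have n_gt0 : (0 < n)%N by apply: leq_ltn_trans (ltn_ord j).
pose t := tperm (Ordinal n_gt0) j.
have chi_t2 : chi (window zeta (fun=> 0%N) t) * chi (window zeta (fun=> 0%N) t) = 1.
  by rewrite -sgn_mul_window tperm2 window1 (sgn_1 chiP).
have -> : window zeta (fun k => k == j) 1%g
    = window zeta (fun=> 0%N) t *m (Defs.gen0 n zeta *m window zeta (fun=> 0%N) t).
  rewrite /Defs.gen0 !mul_window mulg1 tperm2; apply: eq_window => k /=.
  rewrite addn0 add0n; congr nat_of_bool.
  by rewrite -[RHS]/(t k == Ordinal n_gt0) -{1}(tpermR (Ordinal n_gt0) j) (inj_eq perm_inj).
have t_inW : inW r zeta (window zeta (fun=> 0%N) t) by apply: window_inW.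
have gen0_inW : inW r zeta (Defs.gen0 n zeta) by apply: window_inW.
rewrite (sgn_M chiP) ?(sgn_M chiP) //; last first.
  by rewrite /Defs.gen0 mul_window; apply: window_inW.
by rewrite mulrCA chi_t2 mulr1 (sgn_gen0 chiP).
Qed.

(** Adding exponents multiplies values, and [a] is the sum over [j] of [a j] copies of the indicator
    of [j]. *)
Lemma sgn_diag (a : 'I_n -> nat) :
  chi (window zeta a 1%g) = zeta ^+ i ^+ \sum_j a j.
Proof.
(* Finite functions carry a pointwise addition, which lets [big_morph] apply. *)
pose phi (b : {ffun 'I_n -> nat}) := chi (window zeta b 1%g).
have phi0 : phi 0 = 1.
  by rewrite /phi -(sgn_1 chiP) -window1; congr chi; apply: eq_window => j; rewrite ffunE.
have phiD : {morph phi : b c / b + c >-> b * c}.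
  move=> b c; rewrite /phi -sgn_mul_window mulg1; congr chi; apply: eq_window => j.
  by rewrite ffunE perm1.
pose d (j : 'I_n) : {ffun 'I_n -> nat} := [ffun k => (k == j) : nat].
have phi_d j : phi (d j) = zeta ^+ i.
  by rewrite -(sgn_delta j) /phi; congr chi; apply: eq_window => k; rewrite ffunE.
have -> : chi (window zeta a 1%g) = phi (\sum_j \sum_(l < a j) d j).
  rewrite /phi; congr chi; apply: eq_window => j.
  rewrite sum_ffunE (bigD1 j) //= [X in _ + X]big1 => [|k ne_kj]; rewrite sum_ffunE.
    by rewrite addr0; under eq_bigr do rewrite ffunE eqxx; rewrite sum1_card card_ord.
  by apply: big1 => l _; rewrite ffunE eq_sym (negPf ne_kj).
rewrite (big_morph phi phiD phi0) expr_sum; apply: eq_bigr => j _.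
rewrite (big_morph phi phiD phi0); under eq_bigr do rewrite phi_d.
by rewrite prodr_const card_ord.
Qed.

(** The matrix factors as the permutation matrix of [s] times the diagonal matrix with exponents
    [a]. *)
Lemma sgn_window (a : 'I_n -> nat) (s : 'S_n) :
  chi (window zeta a s) = (-1) ^+ ninv s * zeta ^+ i ^+ \sum_j a j.
Proof.
rewrite -sgn_perm -sgn_diag -(sgn_mul_window (fun=> 0%N)) mul1g.
by congr chi; apply: eq_window.
Qed.

End Sgn.

(** * Splitting a colored permutation into its one-color words *)

Section Words.
Variables (n r : nat) (a : 'I_n -> 'I_r) (s : 'S_n).

(** The form that [subword_window] gives to the word of color [k]. *)
Definition color_word (k : 'I_r) : seq (nat * nat) :=
  [seq ((s j).+1, j.+1) | j <- enum 'I_n & a j == k].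

Lemma sum_color_word (k : 'I_r) (F : nat * nat -> nat) :
  (\sum_(z <- color_word k) F z = \sum_(j | a j == k) F ((s j).+1, j.+1))%N.
Proof. by rewrite big_map big_filter big_enum_cond. Qed.

Lemma color_word_uniq1 (k : 'I_r) : uniq (unzip1 (color_word k)).
Proof.
rewrite /unzip1 -map_comp map_inj_uniq; first exact: filter_uniq (enum_uniq _).
by move=> i j /= [] /val_inj /perm_inj.
Qed.

Lemma color_word_sorted2 (k : 'I_r) : sorted ltn (unzip2 (color_word k)).
Proof.
rewrite /unzip2 -map_comp (sorted_map (f := fun j : 'I_n => j.+1)).
apply: sorted_filter => [i j l|]; first exact: ltn_trans.
have := iota_ltn_sorted 0 n; rewrite -val_enum_ord sorted_map.
by apply: sub_sorted => i j.
Qed.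

Lemma color_word_disjoint (k l : 'I_r) (z z' : nat * nat) :
  k != l -> z \in color_word k -> z' \in color_word l ->
  z.1 != z'.1 /\ z.2 != z'.2.
Proof.
move=> ne_kl /mapP[i + ->] /mapP[j + ->] /=; rewrite !mem_filter.
move=> /andP[/eqP ai _] /andP[/eqP aj _]; rewrite !eqSS !val_eqE (inj_eq perm_inj).
suff /negPf-> : i != j by [].
by apply: contraNneq ne_kl => ij; rewrite -ai -aj ij.
Qed.

Lemma ninv_color_words :
  (ninv s = \sum_k \sum_l winv (color_word k) (color_word l))%N.
Proof.
rewrite /ninv (partition_big a predT) //=; apply: eq_bigr => k _.
rewrite /winv; under [RHS]eq_bigr do rewrite sum_color_word.
rewrite [RHS]exchange_big /=; apply: eq_bigr => p _.
rewrite (partition_big a predT) //=; apply: eq_bigr => l _.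
by rewrite sum_color_word; apply: eq_bigr => q _; rewrite !ltnS.
Qed.

Lemma sum_color_word_sizes :
  (\sum_(k < r) k * size (color_word k) = \sum_j a j)%N.
Proof.
rewrite [RHS](partition_big a predT) //=; apply: eq_bigr => k _.
rewrite -sum1_size sum_color_word big_distrr /=.
by apply: eq_bigr => j /eqP->; rewrite muln1.
Qed.

Variables P Q : multitableau r.
Hypothesis rs_color_word : forall k, rs (color_word k) = (P k, Q k).

Lemma color_word_rs (k : 'I_r) :
  [/\ perm_eq (labels (P k)) (unzip1 (color_word k)),
      perm_eq (labels (Q k)) (unzip2 (color_word k))
    & (winv (color_word k) (color_word k)
        = e1 (P k) + size (Inv1 (P k)) + size (Inv1 (Q k)) %[mod 2])%N].
Proof.
have := rs_parity (color_word_sorted2 k) (color_word_uniq1 k).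
by rewrite rs_color_word.
Qed.

(** Pairs of one color are handled by [rs_parity]; for [k < l] the two orders of the colors are
    grouped, as [winv_cross] requires. *)
Lemma ninv_parity : ninv s = (e P + Defs.inv P + Defs.inv Q)%N %[mod 2].
Proof.
rewrite ninv_color_words sum_ord_symmetrize.
have -> : (e P + Defs.inv P + Defs.inv Q
    = \sum_k (e1 (P k) + size (Inv1 (P k)) + size (Inv1 (Q k)))
      + \sum_(k < r) \sum_(l < r | k < l)
          (size (Inv2 (P k) (P l)) + size (Inv2 (Q k) (Q l))))%N.
  rewrite /e /Defs.inv !big_split /=.
  under [X in _ = (_ + X)%N]eq_bigr do rewrite big_split.
  by rewrite big_split /=; ring.
rewrite -modnDm -[in RHS]modnDm; congr ((_ + _) %% _)%N; apply: eq_sum_mod => k _.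
  by have [_ _ ->] := color_word_rs k.
apply: eq_sum_mod => l lt_kl; rewrite winv_cross.
  rewrite !size_Inv2; have [P1 Q1 _] := color_word_rs k; have [P2 Q2 _] := color_word_rs l.
  by rewrite (perm_cross P1 P2) (perm_cross Q1 Q2).
move=> z z'; apply: color_word_disjoint.
by rewrite -val_eqE neq_ltn lt_kl.
Qed.

(** [P k] and [Q k] both have as many boxes as the word has letters, so each spin is half the sum of
    the colors. *)
Lemma spin_color_words : spin P + spin Q = (\sum_j a j)%:R.
Proof.
have spinE T : (forall k, nboxes (T k) = size (color_word k)) ->
    spin T = 2^-1 * (\sum_j a j)%:R.
  move=> sizeT; rewrite /spin -sum_color_word_sizes natr_sum; congr (_ * _).
  by apply: eq_bigr => k _; rewrite sizeT.
rewrite !spinE => [|k|k]; last 2 first.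
- by have [_ /perm_size + _] := color_word_rs k; rewrite size_map.
- by have [/perm_size + _ _] := color_word_rs k; rewrite size_map.
by field.
Qed.

End Words.

Theorem mainTheorem1 (C : numClosedFieldType) (r p n : nat) (r_gt0 : (0 < r)%N)
    (p_gt0 : (0 < p)%N) (n_gt0 : (0 < n)%N) (p_dvd_r : (p %| r)%N)
    (zeta : C) (zeta_prim : r.-primitive_root zeta)
    (w : 'M[C]_n) (w_in_G : inG r p zeta w)
    (P Q : multitableau r) (RS_w : RS r zeta w = (P, Q))
    (i : nat) (i_lt_r : (i < r)%N)
    (sgn_i : 'M[C]_n -> C) (sgn_iP : is_sgn r zeta i sgn_i) :
  sgn_i w = (-1) ^+ e P * (zeta ^+ i) ^+ Num.truncn (spin P + spin Q)
            * sign C P * sign C Q.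
Proof.
have [a [s wE]] := inG_window zeta_prim w_in_G.
have rsE k : rs (color_word a s k) = (P k, Q k).
  rewrite [LHS]surjective_pairing /color_word -(subword_window a s k zeta_prim) -wE.
  by case: RS_w => <- <-.
(* The sum of the spins is now a natural number, so [natrK] removes the truncation. *)
rewrite wE (sgn_window zeta_prim sgn_iP) (spin_color_words rsE) natrK.
have -> : (-1) ^+ ninv s = (-1) ^+ (e P + Defs.inv P + Defs.inv Q)%N :> C.
  by rewrite -signr_odd -[RHS]signr_odd -!modn2 (ninv_parity rsE).
by rewrite /sign !exprD; ring.
Qed.
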